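(* Let $u(x,\rho)=\rho+v(x)\rho^2+w(x)\rho^3+z(x)\rho^4+l(x)\rho^5\log\rho+h(x)\rho^5+O(\rho^6)$ be a formal solution to the singular CR Yamabe problem near nonsingular points $x$ of $\Sigma=\partial M$. Then $$v(x)=-\tfrac16H(x),$$ where $H=\omega(e_1)=\langle\nabla_{e_1}e_1,e_2\rangle$ is the $p$-mean curvature of $\Sigma$.
   Context: Pseudohermitian notation. $(M,J,\theta)$ is a 3-dimensional pseudohermitian manifold with boundary $\Sigma=\partial M$: $\theta$ is a contact form, $\xi=\ker\theta$, $J:\xi\to\xi$, $J^2=-\mathrm{Id}$, Levi metric $\frac12d\theta(\cdot,J\cdot)$ positive definite on $\xi$; $T$ is the Reeb field; $g_\theta=\langle\cdot,\cdot\rangle=\theta\otimes\theta+\frac12d\theta(\cdot,J\cdot)$; $\nabla$ is the Tanaka--Webster connection. For an orthonormal frame $e_1,e_2=Je_1$ of $\xi$ the real 1-form $\omega$ is given by $\nabla e_1=\omega\otimes e_2$, $\nabla e_2=-\omega\otimes e_1$; $W$ is the Webster curvature, $d\omega(e_1,e_2)=-2W$, and $R=2W$. Frame and defining function. A point $x\in\Sigma$ is nonsingular if $T_x\Sigma\neq\xi_x$. At such $x$, $e_1$ is a unit vector in $T_x\Sigma\cap\xi_x$ and $e_2=Je_1$, with sign chosen so that $\langle e_2,\nu\rangle>0$, $\nu$ the unit inner normal. Let $\gamma(\rho)=\exp_x(\rho e_2)$ be the solution of $\nabla_{\dot\gamma}\dot\gamma=0$, $\gamma(0)=x$, $\dot\gamma(0)=e_2$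 (so $\dot\gamma\in\xi$ is unit). The function $\rho$ is defined near nonsingular points by $\rho(\exp_x(\rho e_2))=\rho$; functions are written as $u(x,\rho)=u(\exp_x(\rho e_2))$. The frame is extended by $e_2:=\dot\gamma=\partial_\rho$, $e_1:=-Je_2$ (so $\omega(e_2)=0$). Formal solution. Put $\triangle_Pu=e_1e_1(u)+e_2e_2(u)-\omega(e_1)e_2(u)+\omega(e_2)e_1(u)$ and $|d_Pu|^2=e_1(u)^2+e_2(u)^2$. The singular CR Yamabe problem asks for $u>0$ inside $M$, $u=0$ on $\Sigma$, such that $u^{-2}\theta$ has Webster curvature $-4$ (i.e. $\widetilde R=-8$). A formal solution is a function $u$, positive for $\rho>0$ small, with an expansion (differentiable term by term, smooth coefficients on the nonsingular part of $\Sigma$) $u=c(x)\rho+v(x)\rho^2+w(x)\rho^3+z(x)\rho^4+l(x)\rho^5\log\rho+h(x)\rho^5+O(\rho^6)$ satisfying $|d_Pu|^2-\frac12u\triangle_Pu-\frac18Ru^2=1+O(\rho^5\log\rho)$; then $c\equiv1$. *)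

(* Defs.v *)
(* A smooth 3-manifold with boundary is a Hausdorff second countable space with
   a maximal atlas of charts into the half-space {y | 0 <= rho y}.  Tensor
   fields are given by their components in the charts, as functions of the
   chart coordinates; tangent vectors are row vectors and covectors are column
   vectors, so that a (1,1)-tensor acts on tangent vectors from the right. *)
From HB Require Import structures.
From mathcomp Require Import all_boot all_order all_algebra.
From mathcomp Require Import all_classical all_reals all_analysis.

Set Implicit Arguments.
Unset Strict Implicit.
Unset Printing Implicit Defensive.
Import Order.TTheory GRing.Theory Num.Theory.
Import numFieldNormedType.Exports.
Local Open Scope classical_set_scope.
Local Open Scope ring_scope.

Section Calculus.
Context {R : realType}.
Local Notation pt3 := 'rV[R]_3.

Definition rho (y : pt3) : R := y ord0 ord_max.
Definition basis_vec (a : 'I_3) : pt3 := delta_mx ord0 a.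
Definition foot (y : pt3) : pt3 := y - rho y *: basis_vec ord_max.
Definition half_space : set pt3 := [set y | 0 <= rho y].

Definition diff_quotient (f : R -> R) (t h : R) : R := h^-1 * (f (t + h) - f t).

(* Derivative of [f] relative to [D]: one-sided at the endpoints of an
   interval. *)
Definition derivable_in (D : set R) (f : R -> R) (t : R) : Prop :=
  cvg (diff_quotient f t h @[h --> within [set h | D (t + h)] 0^']).
Definition derive_in (D : set R) (f : R -> R) (t : R) : R :=
  lim (diff_quotient f t h @[h --> within [set h | D (t + h)] 0^']).

(* Partial derivatives relative to the half-space: one-sided in the last
   direction at points with [rho y = 0], two-sided otherwise. *)
Definition line_in (a : 'I_3) (y : pt3) : set R :=
  [set t | half_space (y + t *: basis_vec a)].
Definition pderivable (a : 'I_3) (f : pt3 -> R) (y : pt3) : Prop :=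
  derivable_in (line_in a y) (fun t => f (y + t *: basis_vec a)) 0.
Definition pd (a : 'I_3) (f : pt3 -> R) (y : pt3) : R :=
  derive_in (line_in a y) (fun t => f (y + t *: basis_vec a)) 0.
Definition pds (s : seq 'I_3) (f : pt3 -> R) : pt3 -> R := foldr pd f s.

(* Meant for [V] relatively open in the half-space. *)
Definition Ck_on (k : nat) (V : set pt3) (f : pt3 -> R) : Prop :=
  forall s : seq 'I_3, (size s <= k)%N ->
    {within V, continuous (pds s f)} /\
    ((size s < k)%N -> forall a y, V y -> pderivable a (pds s f) y).
Definition smooth_on (V : set pt3) (f : pt3 -> R) : Prop :=
  forall k, Ck_on k V f.
Definition mx_smooth_on m n (V : set pt3) (A : pt3 -> 'M[R]_(m, n)) : Prop :=
  forall i j, smooth_on V (fun y => A y i j).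

Definition ev (alpha : 'cV[R]_3) (X : pt3) : R := (X *m alpha) ord0 ord0.

Definition act (X : pt3 -> pt3) (f : pt3 -> R) (y : pt3) : R :=
  \sum_a X y ord0 a * pd a f y.

(* d alpha (X, Y) = X (alpha Y) - Y (alpha X) - alpha [X, Y] (no factor 1/2) *)
Definition dform (alpha : pt3 -> 'cV[R]_3) (y X Y : pt3) : R :=
  \sum_a \sum_b (pd a (fun y' => alpha y' b ord0) y
                 - pd b (fun y' => alpha y' a ord0) y)
                * X ord0 a * Y ord0 b.

(* [G y a b] is the vector nabla_{d_a} d_b at [y]. *)
Definition christoffel := pt3 -> 'I_3 -> 'I_3 -> pt3.

(* (nabla_X Y)(y), for a tangent vector [X] at [y] and a vector field [Y] *)
Definition nabla (G : christoffel) (y X : pt3) (Y : pt3 -> pt3) : pt3 :=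
  \row_k \sum_a X ord0 a *
    (pd a (fun y' => Y y' ord0 k) y + \sum_b Y y ord0 b * G y a b ord0 k).

Definition torsion (G : christoffel) (y X Y : pt3) : pt3 :=
  \sum_a \sum_b (X ord0 a * Y ord0 b) *: (G y a b - G y b a).

Definition geodesic (G : christoffel) (D : set R) (gamma : R -> pt3) : Prop :=
  let g' t : pt3 := \row_k derive_in D (fun s => gamma s ord0 k) t in
  (forall t, D t -> forall k, derivable_in D (fun s => gamma s ord0 k) t /\
                              derivable_in D (fun s => g' s ord0 k) t) /\
  (forall t, D t -> forall k,
     derive_in D (fun s => g' s ord0 k) t
     + \sum_a \sum_b g' t ord0 a * g' t ord0 b * G (gamma t) a b ord0 k = 0).

End Calculus.
Arguments christoffel : clear implicits.

Record chart (R : realType) (M : topologicalType) := Chart {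
  dom : set M;
  crd : M -> 'rV[R]_3;
  pnt : 'rV[R]_3 -> M (* inverse of [crd] on [crd @` dom] *) }.

Section Charts.
Context {R : realType} {M : topologicalType}.
Implicit Types c d : chart R M.

Definition cod c : set 'rV[R]_3 := crd c @` dom c.

Definition is_chart c : Prop :=
  [/\ open (dom c),
      exists2 O : set 'rV[R]_3, open O & cod c = O `&` half_space,
      {in dom c, cancel (crd c) (pnt c)},
      {within dom c, continuous (crd c)} &
      {within cod c, continuous (pnt c)}].

Definition transition c d (y : 'rV[R]_3) : 'rV[R]_3 := crd d (pnt c y).
Definition overlap c d : set 'rV[R]_3 := crd c @` (dom c `&` dom d).
Definition compatible c d : Prop :=
  mx_smooth_on (overlap c d) (transition c d) /\
  mx_smooth_on (overlap d c) (transition d c).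
Definition jacobian c d (y : 'rV[R]_3) : 'M[R]_3 :=
  \matrix_(a, b) pd a (fun y' => transition c d y' ord0 b) y.

End Charts.

Record bmanifold (R : realType) := BManifold {
  carrier :> topologicalType;
  _ : hausdorff_space carrier;
  _ : @second_countable carrier;
  atlas : set (chart R carrier);
  _ : forall c, atlas c -> is_chart c;
  _ : forall x, exists2 c, atlas c & dom c x;
  _ : forall c d, atlas c -> atlas d -> compatible c d;
  _ : forall c, is_chart c -> (forall d, atlas d -> compatible c d) -> atlas c }.

(* Equivalently, for some chart at [x], by invariance of the boundary. *)
Definition boundary (R : realType) (M : bmanifold R) : set M :=
  [set x | forall c, @atlas R M c -> dom c x -> rho (crd c x) = 0].

(* [J] is extended from xi = ker theta to the tangent bundle by J T = 0, where
   T is the Reeb field. *)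
Record pseudohermitian (R : realType) (M : bmanifold R) := Pseudohermitian {
  theta : chart R M -> 'rV[R]_3 -> 'cV[R]_3;
  J : chart R M -> 'rV[R]_3 -> 'M[R]_3;
  reeb : chart R M -> 'rV[R]_3 -> 'rV[R]_3;
  _ : forall c, @atlas R M c ->
      [/\ mx_smooth_on (cod c) (theta c), mx_smooth_on (cod c) (J c) &
          mx_smooth_on (cod c) (reeb c)];
  _ : forall c d, @atlas R M c -> @atlas R M d -> forall y, overlap c d y ->
      let A := jacobian c d y in let y' := transition c d y in
      [/\ theta c y = A *m theta d y', J c y *m A = A *m J d y' &
          reeb c y *m A = reeb d y'];
  (* theta /\ d theta <> 0 *)
  _ : forall c, @atlas R M c -> forall y, cod c y ->
      let e := @basis_vec R in
      let i0 : 'I_3 := inord 0 in let i1 : 'I_3 := inord 1 in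
      let i2 : 'I_3 := inord 2 in
      ev (theta c y) (e i0) * dform (theta c) y (e i1) (e i2)
      + ev (theta c y) (e i1) * dform (theta c) y (e i2) (e i0)
      + ev (theta c y) (e i2) * dform (theta c) y (e i0) (e i1) != 0;
  _ : forall c, @atlas R M c -> forall y, cod c y ->
      ev (theta c y) (reeb c y) = 1 /\
      (forall X, dform (theta c) y (reeb c y) X = 0);
  _ : forall c, @atlas R M c -> forall y, cod c y ->
      [/\ reeb c y *m J c y = 0,
          forall X, ev (theta c y) X = 0 -> ev (theta c y) (X *m J c y) = 0 &
          forall X, ev (theta c y) X = 0 -> X *m J c y *m J c y = - X];
  _ : forall c, @atlas R M c -> forall y, cod c y ->
      forall X, ev (theta c y) X = 0 -> X != 0 ->
      0 < 2^-1 * dform (theta c) y X (X *m J c y) }.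

Section Geometry.
Context {R : realType} {M : bmanifold R} (P : pseudohermitian M).
Variable c : chart R M.
Local Notation pt3 := 'rV[R]_3.

Definition xi (y : pt3) : set pt3 := [set X | ev (theta P c y) X = 0].

Definition g (y X Y : pt3) : R :=
  ev (theta P c y) X * ev (theta P c y) Y
  + 2^-1 * dform (theta P c) y X (Y *m J P c y).

(* The Tanaka-Webster connection is determined by these conditions, so its
   Christoffel symbols need only be given in the chart at hand. *)
Definition tanaka_webster (G : christoffel R) : Prop :=
  let vf Y := mx_smooth_on (cod c) (Y : pt3 -> pt3) in
  [/\ forall a b, mx_smooth_on (cod c) (fun y => G y a b),
      (forall y X, cod c y -> nabla G y X (reeb P c) = 0) /\
      (forall Y, vf Y -> (forall y, cod c y -> xi y (Y y)) ->
         forall y X, cod c y -> xi y (nabla G y X Y)),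
      forall Y, vf Y -> forall y X, cod c y ->
        nabla G y X (fun y' => Y y' *m J P c y') = nabla G y X Y *m J P c y,
      forall Y Z, vf Y -> vf Z -> forall y X, cod c y ->
        act (fun=> X) (fun y' => g y' (Y y') (Z y')) y
        = g y (nabla G y X Y) (Z y) + g y (Y y) (nabla G y X Z) &
      forall y, cod c y ->
        (forall X Y, xi y X -> xi y Y ->
           torsion G y X Y = dform (theta P c) y X Y *: reeb P c y) /\
        (forall X, xi y X ->
           torsion G y (reeb P c y) (X *m J P c y)
           = - (torsion G y (reeb P c y) X *m J P c y))].

(* tangent space of the boundary at a point with [rho y = 0] *)
Definition tangent_boundary : set pt3 := [set X | rho X = 0].

Definition nonsingular (y : pt3) : Prop := tangent_boundary <> xi y.

Definition inner_unit_normal (y nu : pt3) : Prop :=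
  [/\ g y nu nu = 1, forall X, tangent_boundary X -> g y nu X = 0 & 0 < rho nu].

(* The coordinates are (x, rho): the point with coordinates [y] is
   exp_x (rho y * e_2), where x has coordinates [foot y].  Thus every boundary
   point of the chart is nonsingular and the [rho]-lines starting there are the
   geodesics with initial velocity e_2 = J e_1. *)
Definition normal_chart (G : christoffel R) : Prop :=
  [/\ @atlas R M c,
      tanaka_webster G,
      forall y t, cod c y -> 0 <= t <= rho y ->
        cod c (foot y + t *: basis_vec ord_max) &
      forall y, cod c y -> rho y = 0 ->
        let gamma t := y + t *: basis_vec ord_max in
        let D := [set t : R | 0 <= t /\ cod c (gamma t)] in
        nonsingular y /\
        exists e1 : pt3,
          let e2 := e1 *m J P c y in
          [/\ tangent_boundary e1, xi y e1, g y e1 e1 = 1,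
              forall nu, inner_unit_normal y nu -> 0 < g y e2 nu &
              geodesic G D gamma /\
              forall k, derive_in D (fun t => gamma t ord0 k) 0 = e2 ord0 k]].

(* The frame of a normal chart: e_2 is the velocity d/d rho of the [rho]-lines
   and e_1 = - J e_2. *)
Definition e2 (y : pt3) : pt3 := basis_vec ord_max.
Definition e1 (y : pt3) : pt3 := - (e2 y *m J P c y).

Variable G : christoffel R.

(* nabla e_1 = omega (x) e_2 *)
Definition omega (y : pt3) : 'cV[R]_3 :=
  \col_a g y (nabla G y (basis_vec a) e1) (e2 y).

(* d omega (e_1, e_2) = - 2 W *)
Definition webster_curvature (y : pt3) : R :=
  - (2^-1 * dform omega y (e1 y) (e2 y)).

Definition p_mean_curvature (x : M) : R :=
  let y := crd c x in ev (omega y) (e1 y).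

Definition sublaplacian (f : pt3 -> R) (y : pt3) : R :=
  act e1 (act e1 f) y + act e2 (act e2 f) y
  - ev (omega y) (e1 y) * act e2 f y + ev (omega y) (e2 y) * act e1 f y.

Definition sqnorm_dP (f : pt3 -> R) (y : pt3) : R :=
  act e1 f y ^+ 2 + act e2 f y ^+ 2.

Definition yamabe_lhs (f : pt3 -> R) (y : pt3) : R :=
  sqnorm_dP f y - 2^-1 * f y * sublaplacian f y
  - 8^-1 * (2 * webster_curvature y) * f y ^+ 2.

Definition inside : set pt3 := [set y | cod c y /\ 0 < rho y].

(* y tends to a boundary point from inside, so that O is locally uniform *)
Definition inside_near (y0 : pt3) : set_system pt3 := within inside (nbhs y0).

(* The coefficients are functions on the boundary, read at [foot y]; all
   derivatives of order at most 2 of the expansion may be taken term by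
   term. *)
Definition formal_solution (u v w z l h : M -> R) : Prop :=
  let U y := u (pnt c y) in
  let at_foot (f : M -> R) y := f (pnt c (foot y)) in
  let expansion y :=
    rho y + at_foot v y * rho y ^+ 2 + at_foot w y * rho y ^+ 3
    + at_foot z y * rho y ^+ 4 + at_foot l y * (rho y ^+ 5 * ln (rho y))
    + at_foot h y * rho y ^+ 5 in
  let remainder y := U y - expansion y in
  [/\ [/\ smooth_on (cod c) (at_foot v), smooth_on (cod c) (at_foot w),
          smooth_on (cod c) (at_foot z), smooth_on (cod c) (at_foot l) &
          smooth_on (cod c) (at_foot h)],
      Ck_on 2 inside U,
      forall y0, cod c y0 -> rho y0 = 0 ->
        \forall y \near inside_near y0, 0 < U y,
      forall y0, cod c y0 -> rho y0 = 0 ->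
        forall s : seq 'I_3, (size s <= 2)%N ->
        let F := inside_near y0 in
        pds s remainder =O_F (fun y => rho y ^+ (6 - count_mem ord_max s) : R) &
      forall y0, cod c y0 -> rho y0 = 0 ->
        let F := inside_near y0 in
        (fun y => yamabe_lhs U y - 1) =O_F (fun y => rho y ^+ 5 * ln (rho y) : R)].

End Geometry.

(* Main.v *)
Require Import Defs.
From mathcomp Require Import all_boot all_order all_algebra.
From mathcomp Require Import all_classical all_reals all_analysis.
From mathcomp Require Import ring lra zify.
Import Order.TTheory GRing.Theory Num.Theory.
Import numFieldNormedType.Exports.
Local Open Scope classical_set_scope.
Local Open Scope ring_scope.

Set Implicit Arguments.
Unset Strict Implicit.
Unset Printing Implicit Defensive.

(** The formula comes from the coefficient of [rho] in the Yamabe equation.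
Fix a boundary point [y0].  On the boundary [e_1] is tangent, so the [rho]
component of [e_1] is O(rho), and so are its derivatives along the boundary;
hence for [u = rho + v rho^2 + O(rho^3)] both [e_1 u] and [e_1 e_1 u] are
O(rho).  As [e_2 = d/d rho], this leaves
[[
  |d_P u|^2     = 1 + 4 v rho + O(rho^2),
  triangle_P u  = 2 v - omega(e_1) + O(rho),
  R u^2         = O(rho^2),
]]
and therefore
[[
  |d_P u|^2 - u triangle_P u / 2 - R u^2 / 8
    = 1 + rho (3 v + omega(e_1) / 2) + O(rho^2).
]]
The left-hand side is [1 + O(rho^5 log rho)], so [3 v + omega(e_1) / 2] tends
to 0 at [y0]; it is continuous there, so it is 0 at [y0], which is the claim.

All these estimates are needed only on the segment
[t |-> y0 + t d/d rho], [t > 0], above the given boundary point.  The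
derivatives of the functions involved are controlled with a single predicate,
[jet V y0 n k f]: each derivative of [f] of order at most [n] exists
on [V] and is O(t^(k - j)) on the segment, [j] being the number of derivatives
in the direction of [rho].  Thus a tangential derivative loses nothing and a
[rho]-derivative loses one order.  The predicate is multiplicative in [k]
([jetM]), so the estimates above are obtained by weighing each factor: [rho]
has weight 1, a smooth function weight 0, and a smooth function that is zero on
the boundary weight 1 ([jet_boundary]).  In particular
[e_1] maps weight 1 to weight 1 ([jet_act_e1]), although one of its terms
differentiates in [rho]: the coefficient of that term has weight 1.
*)

(** * One-sided partial derivatives in the half-space *)

Lemma at_right_within {R : realType} (D : set R) :
  (\forall t \near (0 : R)^'+, D t) -> 0^'+ `=>` within D 0^'.
Proof.
move=> HD P HP.
have {}HP : \forall t \near (0 : R), t != 0 -> D t -> P t by exact: HP.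
suff : \forall t \near (0 : R), 0 < t -> P t by [].
have {}HD : \forall t \near (0 : R), 0 < t -> D t by exact: HD.
by apply: filterS2 HD HP => t Dt Pt t0; apply: Pt; [rewrite gt_eqF | exact: Dt].
Qed.

(** Properness is what makes a limit relative to [D], hence a one-sided
derivative, unique. *)
Lemma within_dnbhs_proper {R : realType} (D : set R) :
  (\forall t \near (0 : R)^'+, D t) -> ProperFilter (within D 0^').
Proof.
move=> HD; split; last exact: within_filter.
by move=> /(at_right_within HD); exact: (@filter_not_empty _ (0 : R)^'+).
Qed.

Section PartialDerivatives.
Context {R : realType}.
Local Notation pt3 := 'rV[R]_3.
Implicit Types (a b : 'I_3) (f g : pt3 -> R) (y : pt3).

Definition approach a y : set_system R :=
  within [set h | half_space (y + h *: basis_vec a)] 0^'.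

Definition slope a f y (h : R) : R := h^-1 * (f (y + h *: basis_vec a) - f y).

(** [pd a f y] is a limit chosen by [lim] and says nothing where [f] is not
derivable; the calculus rules are proved for this relation, which holds the
value and its existence together. *)
Definition is_pd a f y (l : R) : Prop := slope a f y h @[h --> approach a y] --> l.

Lemma rho_shift a y (t : R) :
  rho (y + t *: basis_vec a) = rho y + t * (a == ord_max)%:R.
Proof. by rewrite /rho /basis_vec !mxE eqxx eq_sym. Qed.

Lemma half_space_shift a y (t : R) :
  half_space y -> 0 <= t -> half_space (y + t *: basis_vec a).
Proof. by move=> y0 t0; rewrite /half_space /= rho_shift addr_ge0// mulr_ge0. Qed.

Lemma at_right_approach a y : half_space y -> 0^'+ `=>` approach a y.
Proof.
move=> hy; apply: at_right_within; apply: filterS (nbhs_right_gt 0) => t t0.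
exact/half_space_shift/ltW.
Qed.

Global Instance approach_filter a y : Filter (approach a y).
Proof. exact: within_filter. Qed.

Lemma approach_proper a y : half_space y -> ProperFilter (approach a y).
Proof.
move=> hy; apply: within_dnbhs_proper.
apply: filterS (nbhs_right_gt 0) => t t0; exact/half_space_shift/ltW.
Qed.

Lemma line_filterE a y :
  within [set h | line_in a y (0 + h)] 0^' = approach a y.
Proof. by under eq_set do rewrite add0r. Qed.

Lemma slopeE a f y :
  diff_quotient (fun t => f (y + t *: basis_vec a)) 0 = slope a f y.
Proof.
by apply/funext => t; rewrite /diff_quotient /slope add0r scale0r addr0.
Qed.

Lemma pderivable_is_pd a f y : pderivable a f y -> is_pd a f y (pd a f y).
Proof.
rewrite /pderivable /derivable_in /pd /derive_in /is_pd line_filterE.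
by rewrite slopeE.
Qed.

Lemma is_pd_pd a f y l : half_space y -> is_pd a f y l ->
  pderivable a f y /\ pd a f y = l.
Proof.
move=> hy; rewrite /pderivable /derivable_in /pd /derive_in /is_pd line_filterE.
rewrite slopeE => fl; have ? := approach_proper a hy.
by split; [exact: cvgP fl | exact: cvg_lim].
Qed.

Lemma approach0 a y : h @[h --> approach a y] --> (0 : R).
Proof.
apply: cvg_trans (@nbhs_dnbhs _ (0 : R)); exact: cvg_within.
Qed.

Lemma approach_neq0 a y : \forall h \near approach a y, h != 0.
Proof.
by rewrite /approach near_withinE; near=> h => _; near: h; exact: nbhs_dnbhs_neq.
Unshelve. all: by end_near. Qed.

Lemma approach_half a y :
  \forall h \near approach a y, half_space (y + h *: basis_vec a).
Proof. exact: withinT. Qed.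

Lemma is_pd_cvg a f y l : is_pd a f y l ->
  f (y + h *: basis_vec a) @[h --> approach a y] --> f y.
Proof.
move=> fl.
have -> : (fun h => f (y + h *: basis_vec a)) = fun h => h * slope a f y h + f y.
  apply/funext => h; rewrite /slope; have [->|h0] := eqVneq h 0.
    by rewrite scale0r mul0r addr0 add0r.
  by rewrite mulrA mulfV// mul1r subrK.
rewrite -[X in _ --> X]add0r; apply: cvgD; last exact: cvg_cst.
by rewrite -(mul0r l); apply: cvgM => //; exact: approach0.
Qed.

Lemma is_pd_cst a (k : R) y : is_pd a (fun=> k) y 0.
Proof.
rewrite /is_pd (_ : slope _ _ _ = fun=> 0); first exact: cvg_cst.
by apply/funext => h; rewrite /slope subrr mulr0.
Qed.

Lemma is_pdD a f g y l k : is_pd a f y l -> is_pd a g y k ->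
  is_pd a (fun y => f y + g y) y (l + k).
Proof.
move=> fl gk; rewrite /is_pd (_ : slope _ _ _ = slope a f y \+ slope a g y).
  exact: cvgD.
by apply/funext => h; rewrite /slope /= -mulrDr opprD addrACA.
Qed.

Lemma is_pdM a f g y l k : is_pd a f y l -> is_pd a g y k ->
  is_pd a (fun y => f y * g y) y (l * g y + f y * k).
Proof.
move=> fl gk.
rewrite /is_pd (_ : slope _ _ _ = fun h =>
  slope a f y h * g (y + h *: basis_vec a) + f y * slope a g y h).
  apply: cvgD; first by apply: cvgM => //; exact: is_pd_cvg gk.
  by apply: cvgM => //; exact: cvg_cst.
apply/funext => h; rewrite /slope /= mulrCA -mulrA -mulrDr; congr (_ * _).
by rewrite mulrBl mulrBr addrA subrK.
Qed.

Lemma is_pd_rho a y : is_pd a rho y (a == ord_max)%:R.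
Proof.
rewrite /is_pd; apply: cvg_near_cst; apply: filterS (approach_neq0 a y) => h h0.
by rewrite /slope rho_shift addrAC subrr add0r mulKf.
Qed.

Lemma is_pd_near a f g y l : f y = g y ->
  (\forall h \near approach a y, f (y + h *: basis_vec a) = g (y + h *: basis_vec a)) ->
  is_pd a f y l -> is_pd a g y l.
Proof.
move=> fgy fg; apply: cvg_trans; apply: near_eq_cvg.
by apply: filterS fg => h fgh; rewrite /slope fgy fgh.
Qed.

(** The derivatives at a point of such a set depend only on the values in the
set ([is_pd_ext]). *)
Definition relopen (V : set pt3) := forall y, V y ->
  half_space y /\ \forall y' \near y, half_space y' -> V y'.

Lemma shift_cvg a y : y + h *: basis_vec a @[h --> (0 : R)] --> y.
Proof.
have -> : nbhs y = nbhs (y + 0 *: basis_vec a) by rewrite scale0r addr0.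
apply: cvgD; first exact: cvg_cst.
by apply: cvgZ; [exact: cvg_id | exact: cvg_cst].
Qed.

Lemma relopen_approach V a y : relopen V -> V y ->
  \forall h \near approach a y, V (y + h *: basis_vec a).
Proof.
move=> oV /oV[hy Vy].
have Vy0 : \forall h \near (0 : R),
    half_space (y + h *: basis_vec a) -> V (y + h *: basis_vec a).
  exact: (@shift_cvg a y _ Vy).
have Va : \forall h \near approach a y,
    half_space (y + h *: basis_vec a) -> V (y + h *: basis_vec a).
  exact: (@approach0 a y _ Vy0).
by apply: filterS2 (approach_half a y) Va => h hh; exact.
Qed.

Lemma is_pd_ext V a f g y l : relopen V -> V y -> (forall y, V y -> f y = g y) ->
  is_pd a f y l -> is_pd a g y l.
Proof.
move=> oV Vy fg; apply: is_pd_near; first exact: fg.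
by apply: filterS (relopen_approach a oV Vy) => h /fg.
Qed.

Lemma is_pd_comp_rho (phi dphi : R -> R) a y :
  is_derive (rho y) 1 phi (dphi (rho y)) ->
  is_pd a (fun y => phi (rho y)) y ((a == ord_max)%:R * dphi (rho y)).
Proof.
move=> dp; case: eqP => [->|ne].
  rewrite mul1r; case: dp => dphi_ phiE.
  pose q h : R := h^-1 *: (phi (h *: 1 + rho y) - phi (rho y)).
  have q0 : q h @[h --> 0^'] --> dphi (rho y) by rewrite -phiE; exact: dphi_.
  have : q h @[h --> approach ord_max y] --> dphi (rho y).
    by apply: cvg_trans q0; apply: cvg_app; exact: cvg_within.
  suff -> : q = slope ord_max (fun y => phi (rho y)) y by [].
  apply/funext => h.
  by rewrite /slope /q rho_shift eqxx mulr1 /GRing.scale /= mulr1 (addrC h).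
rewrite mul0r /is_pd (_ : slope _ _ _ = fun=> 0); first exact: cvg_cst.
apply/funext => h; rewrite /slope rho_shift.
by case: eqP ne => // _ _; rewrite mulr0 addr0 subrr mulr0.
Qed.

End PartialDerivatives.

(** * Orders of vanishing along a vertical segment *)

Section Orders.
Context {R : realType}.
Local Notation pt3 := 'rV[R]_3.
Implicit Types (a b : 'I_3) (f g : pt3 -> R) (y : pt3) (V : set pt3).

Definition vertical (y : pt3) (t : R) : pt3 := y + t *: basis_vec ord_max.

Definition vanish y (k : nat) f : Prop :=
  exists C, \forall t \near (0 : R)^'+, `|f (vertical y t)| <= C * t ^+ k.

Lemma vanish_near y k f g :
  (\forall t \near (0 : R)^'+, f (vertical y t) = g (vertical y t)) ->
  vanish y k f -> vanish y k g.
Proof.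
move=> fg [C fC]; exists C; apply: filterS2 fg fC => t -> //.
Qed.

Lemma vanishD y k f g : vanish y k f -> vanish y k g ->
  vanish y k (fun y => f y + g y).
Proof.
move=> [C fC] [D gD]; exists (C + D); apply: filterS2 fC gD => t fC gD.
by rewrite mulrDl; apply: le_trans (ler_normD _ _) _; exact: lerD.
Qed.

Lemma vanishM y j k f g : vanish y j f -> vanish y k g ->
  vanish y (j + k) (fun y => f y * g y).
Proof.
move=> [C fC] [D gD]; exists (C * D); apply: filterS2 fC gD => t fC gD.
by rewrite normrM exprD mulrACA ler_pM.
Qed.

Lemma vanish_le y j k f : (j <= k)%N -> vanish y k f -> vanish y j f.
Proof.
move=> jk [C fC]; exists `|C|.
near=> t; have t0 : 0 < t by near: t; exact: nbhs_right_gt.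
have t1 : t <= 1 by near: t; apply: nbhs_right_le.
have /le_trans -> // : `|f (vertical y t)| <= C * t ^+ k by near: t.
apply: (@le_trans _ _ (`|C| * t ^+ k)).
  by rewrite ler_wpM2r ?ler_norm// exprn_ge0// ltW.
by rewrite ler_wpM2l// ler_wiXn2l// ltW.
Unshelve. all: by end_near. Qed.

Lemma vanish_cst y (c : R) : vanish y 0 (fun=> c).
Proof. by exists `|c|; apply: nearW => t; rewrite expr0 mulr1. Qed.

Lemma vanish_rho y : rho y = 0 -> vanish y 1 rho.
Proof.
move=> y0; exists 1; apply: filterS (nbhs_right_gt 0) => t t0.
by rewrite /vertical rho_shift y0 eqxx add0r mulr1 mul1r expr1 gtr0_norm.
Qed.

Lemma vanish_bigO y k f (g : pt3 -> R) (W : set pt3) :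
  (\forall t \near (0 : R)^'+, W (vertical y t)) ->
  (let F := within W (nbhs y) in f =O_F g) -> vanish y k g -> vanish y k f.
Proof.
move=> Wy /eqO_bigO/bigO_exP[C C0 fg] [D gD]; exists (C * D).
have {}fg : \forall t \near (0 : R)^'+,
    W (vertical y t) -> `|f (vertical y t)| <= C * `|g (vertical y t)|.
  apply: (@cvg_within _ (nbhs (0 : R))).
  exact: (@shift_cvg _ ord_max y _ fg).
near=> t; apply: (@le_trans _ _ (C * `|g (vertical y t)|)).
  by apply: (near fg t) => //; near: t.
by rewrite -mulrA ler_pM2l//; near: t.
Unshelve. all: by end_near. Qed.

(** The difference quotient has a limit, so it is bounded near the point.  This
is the only source of estimates for smooth functions. *)
Lemma vanish_pderivable y f : half_space y -> pderivable ord_max f y ->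
  vanish y 1 (fun y' => f y' - f y).
Proof.
move=> hy /pderivable_is_pd fl.
have {}fl : slope ord_max f y h @[h --> 0^'+] --> pd ord_max f y.
  by apply: cvg_trans fl; apply: cvg_app; exact: at_right_approach.
exists (`|pd ord_max f y| + 1); near=> t.
have t0 : 0 < t by near: t; exact: nbhs_right_gt.
have : `|pd ord_max f y - slope ord_max f y t| < 1.
  by near: t; move/cvgrPdist_lt: fl; apply.
rewrite expr1 -ler_pdivrMr// => lt1.
have -> : `|f (vertical y t) - f y| / t = `|slope ord_max f y t|.
  by rewrite /slope normrM normfV (gtr0_norm t0) mulrC.
rewrite addrC -lerBlDr; apply: le_trans (ltW lt1).
by rewrite distrC; exact: lerB_dist.
Unshelve. all: by end_near. Qed.

(** * Weighted jets *)

(** The weight [k] drops by one for each derivative in the direction of [rho]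
and is unchanged by the other two.  As the subtraction is truncated, a
derivative that has exhausted the weight is still required to be bounded. *)
Fixpoint jet V y (n k : nat) f : Prop :=
  vanish y k f /\
  if n is n'.+1 then
    forall a, (forall y, V y -> pderivable a f y) /\
              jet V y n' (k - (a == ord_max)) (pd a f)
  else True.

Section JetTheory.
Variables (V : set pt3) (y : pt3).
Hypothesis oV : relopen V.
Hypothesis Vy : \forall t \near (0 : R)^'+, V (vertical y t).
Hypothesis y0 : rho y = 0.
Local Notation jet := (jet V y).

Lemma jet_vanish n k f : jet n k f -> vanish y k f.
Proof. by case: n => [|n] []. Qed.

Lemma vanish_ext k f g : (forall y, V y -> f y = g y) ->
  vanish y k f -> vanish y k g.
Proof. by move=> fg; apply: vanish_near; apply: filterS Vy => t /fg. Qed.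

Lemma relopen_half y' : V y' -> half_space y'.
Proof. by move=> /oV[]. Qed.

Lemma jet_le n j k f : (j <= k)%N -> jet n k f -> jet n j f.
Proof.
elim: n j k f => [|n IH] j k f jk /= [fk H].
  by split => //; exact: vanish_le fk.
split; first exact: vanish_le fk.
by move=> a; have [fa ja] := H a; split => //; apply: IH ja; exact: leq_sub2r.
Qed.

Lemma jetS n k f : jet n.+1 k f -> jet n k f.
Proof.
elim: n k f => [|n IH] k f [fk H]; first by split.
by split=> // a; have [fa ja] := H a; split => //; exact: IH.
Qed.

Lemma jet_ext n k f g : (forall y, V y -> f y = g y) -> jet n k f -> jet n k g.
Proof.
elim: n k f g => [|n IH] k f g fg [fk H].
  by split => //; exact: vanish_ext fk.
split; first exact: vanish_ext fk.
move=> a; have [fa ja] := H a.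
have gE y' : V y' -> pderivable a g y' /\ pd a g y' = pd a f y'.
  move=> Vy'; apply: is_pd_pd; first exact: relopen_half.
  by apply: (is_pd_ext oV Vy' fg); exact: (pderivable_is_pd (fa _ Vy')).
split; first by move=> y' /gE[].
by apply: IH ja => y' /gE[].
Qed.

(** To establish a jet it suffices to name derivatives [df] that have
the right weight. *)
Lemma jet_is_pd n k f (df : 'I_3 -> pt3 -> R) : vanish y k f ->
  (forall a y', V y' -> is_pd a f y' (df a y')) ->
  (forall a, jet n (k - (a == ord_max)) (df a)) -> jet n.+1 k f.
Proof.
move=> fk fd dk; split=> // a.
have E y' : V y' -> pderivable a f y' /\ pd a f y' = df a y'.
  by move=> Vy'; apply: is_pd_pd (fd _ _ Vy'); exact: relopen_half.
split; first by move=> y' /E[].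
by apply: jet_ext (dk a) => y' /E[].
Qed.

Lemma jet_pd n k f a y' : jet n.+1 k f -> V y' -> is_pd a f y' (pd a f y').
Proof. by move=> [_ /(_ a)[fa _]] Vy'; exact: (pderivable_is_pd (fa _ Vy')). Qed.

Lemma pd_jet n k f a : jet n.+1 k f -> jet n (k - (a == ord_max)) (pd a f).
Proof. by move=> [_ /(_ a)[]]. Qed.

Lemma jetD n k f g : jet n k f -> jet n k g -> jet n k (fun y => f y + g y).
Proof.
elim: n k f g => [|n IH] k f g jf jg.
  by split=> //; apply: vanishD; [exact: jet_vanish jf | exact: jet_vanish jg].
apply: (@jet_is_pd _ _ _ (fun a y => pd a f y + pd a g y)).
- by apply: vanishD; [exact: jet_vanish jf | exact: jet_vanish jg].
- by move=> a y' Vy'; apply: is_pdD; apply: jet_pd Vy'; eassumption.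
- by move=> a; apply: IH; exact: pd_jet.
Qed.

(** By the Leibniz rule: each term differentiates one factor only, and so loses
at most what the product may lose. *)
Lemma jetM n j k f g : jet n j f -> jet n k g ->
  jet n (j + k) (fun y => f y * g y).
Proof.
elim: n j k f g => [|n IH] j k f g jf jg.
  by split=> //; apply: vanishM; [exact: jet_vanish jf | exact: jet_vanish jg].
apply: (@jet_is_pd _ _ _ (fun a y => pd a f y * g y + f y * pd a g y)).
- by apply: vanishM; [exact: jet_vanish jf | exact: jet_vanish jg].
- by move=> a y' Vy'; apply: is_pdM; apply: jet_pd Vy'; eassumption.
- move=> a; apply: jetD.
    apply: jet_le (IH _ _ _ _ (pd_jet a jf) (jetS jg)).
    by case: (_ == _); lia.
  apply: jet_le (IH _ _ _ _ (jetS jf) (pd_jet a jg)).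
  by case: (_ == _); lia.
Qed.

Lemma jet0 n k : jet n k (fun=> 0).
Proof.
elim: n k => [|n IH] k.
  by split=> //; exists 0; apply: nearW => t; rewrite normr0 mul0r.
apply: (@jet_is_pd _ _ _ (fun a y => 0)) => //.
  by exists 0; apply: nearW => t; rewrite normr0 mul0r.
by move=> a y' _; exact: is_pd_cst.
Qed.

Lemma jet_cst n (c : R) : jet n 0 (fun=> c).
Proof.
case: n => [|n]; first by split=> //; exact: vanish_cst.
apply: (@jet_is_pd _ _ _ (fun a y => 0)); first exact: vanish_cst.
  by move=> a y' _; exact: is_pd_cst.
by move=> a; exact: jet0.
Qed.

Lemma jetZ n k c f : jet n k f -> jet n k (fun y => c * f y).
Proof. by move=> jf; rewrite -[k]add0n; apply: jetM => //; exact: jet_cst. Qed.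

Lemma jetN n k f : jet n k f -> jet n k (fun y => - f y).
Proof.
move=> jf; apply: jet_ext (jetZ (-1) jf) => y' _; exact: mulN1r.
Qed.

Lemma jetB n k f g : jet n k f -> jet n k g -> jet n k (fun y => f y - g y).
Proof. by move=> jf jg; apply: jetD => //; exact: jetN. Qed.

Lemma jet_sum n k (I : Type) (r : seq I) (Q : pred I) (F : I -> pt3 -> R) :
  (forall i, Q i -> jet n k (F i)) -> jet n k (fun y => \sum_(i <- r | Q i) F i y).
Proof.
move=> H; elim: r => [|i r IH].
  by apply: jet_ext (jet0 n k) => y' _; rewrite big_nil.
have [Qi|nQi] := boolP (Q i).
  by apply: jet_ext (jetD (H i Qi) IH) => y' _; rewrite big_cons Qi.
by apply: jet_ext IH => y' _; rewrite big_cons (negbTE nQi).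
Qed.

Lemma jet_rho n : jet n 1 rho.
Proof.
case: n => [|n]; first by split=> //; exact: vanish_rho.
apply: (@jet_is_pd _ _ _ (fun a y => (a == ord_max)%:R)).
- exact: vanish_rho.
- by move=> a y' _; exact: is_pd_rho.
- by move=> a; case: (a == _); [exact: jet_cst | exact: jet0].
Qed.

Lemma jet_rhoX n k : jet n k (fun y => rho y ^+ k).
Proof.
elim: k => [|k IH].
  by apply: jet_ext (jet_cst n 1) => y' _; rewrite expr0.
by apply: jet_ext (jetM (jet_rho n) IH) => y' _; rewrite exprS.
Qed.

Definition derivable_upto n f := forall s a, (size s < n)%N ->
  forall y, V y -> pderivable a (pds s f) y.

(** The iterated derivatives [pds s f] differentiate last along the head of [s],
whereas [jet] recurs on the first derivative, the last entry of [s]. *)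
Lemma jet_bounds n k f : derivable_upto n f ->
  (forall s, (size s <= n)%N -> vanish y (k - count_mem ord_max s) (pds s f)) ->
  jet n k f.
Proof.
elim: n k f => [|n IH] k f fd fk.
  by split=> //; have := fk [::] isT; rewrite subn0.
split; first by have := fk [::] isT; rewrite subn0.
move=> a; split; first exact: (fd [::]).
apply: IH => [s b|s] sn; rewrite /pds -foldr_rcons.
  by apply: fd; rewrite size_rcons.
have := fk (rcons s a); rewrite size_rcons => /(_ sn).
by rewrite -cats1 count_cat /= addn0 addnC subnDA.
Qed.

Lemma jet_derivable_upto n k f : jet n k f -> derivable_upto n f.
Proof.
elim: n k f => [|n IH] k f; first by move=> _ s a.
move=> [_ H] s; elim/last_ind: s => [|s b _] a.
  by move=> _; have [] := H a.
rewrite size_rcons /pds foldr_rcons => sn; have [_ /IH] := H b; exact.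
Qed.

Lemma pdsB n s f g y' : derivable_upto n f -> derivable_upto n g ->
  (size s <= n)%N -> V y' ->
  pds s (fun y => f y - g y) y' = pds s f y' - pds s g y'.
Proof.
move=> fn gn; elim: s y' => [|a s IH] y' //= sn Vy'.
have := is_pdD (pderivable_is_pd (fn s a sn y' Vy'))
  (is_pdM (is_pd_cst a (-1) y') (pderivable_is_pd (gn s a sn y' Vy'))).
rewrite mul0r add0r mulN1r => H.
apply: (is_pd_pd (relopen_half Vy') _).2.
apply: (is_pd_ext oV Vy' _ H) => y1 Vy1; rewrite IH// 1?ltnW//.
by rewrite mulN1r.
Qed.

Lemma derivable_uptoB n f g : derivable_upto n f -> derivable_upto n g ->
  derivable_upto n (fun y => f y - g y).
Proof.
move=> fn gn s a sn y' Vy'.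
have := is_pdD (pderivable_is_pd (fn s a sn y' Vy'))
  (is_pdM (is_pd_cst a (-1) y') (pderivable_is_pd (gn s a sn y' Vy'))).
move=> H; apply: (is_pd_pd (relopen_half Vy') _).1.
apply: (is_pd_ext oV Vy' _ H) => y1 Vy1.
by rewrite (pdsB fn gn)// ?mulN1r// ltnW.
Qed.

End JetTheory.

Lemma jet_sub V V' y n k f : V' `<=` V -> jet V y n k f -> jet V' y n k f.
Proof.
move=> VV; elim: n k f => [|n IH] k f [fk H]; first by split.
split=> // a; have [fa ja] := H a.
by split; [move=> y' /VV; exact: fa | exact: IH].
Qed.

Lemma smooth_on_pd V a f : smooth_on V f -> smooth_on V (pd a f).
Proof.
move=> fs k s sk; have := fs k.+1 (rcons s a).
by rewrite size_rcons !ltnS /pds foldr_rcons; exact.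
Qed.

Lemma smooth_on_pderivable V a f y : smooth_on V f -> V y -> pderivable a f y.
Proof. by move=> fs; have [_ /(_ isT a y)] := fs 1%N [::] isT. Qed.

(** Boundedness of each derivative along the segment follows from its
derivability at the base point, which belongs to [V]. *)
Lemma jet_smooth V y n f : relopen V -> V y ->
  smooth_on V f -> jet V y n 0 f.
Proof.
move=> oV Vy.
have bounded f' : smooth_on V f' -> vanish y 0 f'.
  move=> fs; have fd := smooth_on_pderivable (a := ord_max) fs Vy.
  have := vanishD (vanish_le (leq0n 1) (vanish_pderivable (oV _ Vy).1 fd))
    (vanish_cst y (f' y)).
  by apply: vanish_near; apply: nearW => t; rewrite subrK.
elim: n f => [|n IH] f fs; split=> //; try exact: bounded.
move=> a; split; first by move=> y'; exact: smooth_on_pderivable.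
by rewrite sub0n; apply: IH; exact: smooth_on_pd.
Qed.

End Orders.

(** * Jets of powers, logarithms and functions zero on the boundary *)

Section MoreJets.
Context {R : realType}.
Local Notation pt3 := 'rV[R]_3.
Implicit Types (a b : 'I_3) (f g : pt3 -> R) (y : pt3) (V : set pt3).

(** From [ln (1 / t) <= 1 / t - 1]. *)
Lemma normr_mul_ln (t : R) : 0 < t -> t <= 1 -> `|t * ln t| <= 1.
Proof.
move=> t0 t1; rewrite normrM (gtr0_norm t0) ler0_norm ?ln_le0//.
rewrite mulrC -ler_pdivlMr// mul1r -lnV//.
have : ln (1 + (t^-1 - 1)) <= t^-1 - 1.
  by apply: le_ln1Dx; rewrite ltrBrDl subrr invr_gt0.
rewrite addrC subrK => /le_trans; apply.
by rewrite lerBlDr lerDl.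
Qed.

Lemma vanish_rhoX_ln y k : rho y = 0 ->
  vanish y k (fun y => rho y ^+ k.+1 * ln (rho y)).
Proof.
move=> y0; exists 1; near=> t.
have t0 : 0 < t by near: t; exact: nbhs_right_gt.
have t1 : t <= 1 by near: t; exact: nbhs_right_le.
rewrite /vertical rho_shift y0 eqxx add0r mulr1 mul1r exprSr -mulrA normrM.
by rewrite normrX (gtr0_norm t0) ler_piMr ?normr_mul_ln// exprn_ge0// ltW.
Unshelve. all: by end_near. Qed.

Lemma is_pd_rhoX a y k :
  is_pd a (fun y => rho y ^+ k.+1) y ((a == ord_max)%:R * (k.+1%:R * rho y ^+ k)).
Proof.
elim: k => [|k IH].
  rewrite expr0 mulr1 mulr1 (_ : (fun y => _) = rho); first exact: is_pd_rho.
  by apply/funext => y'; rewrite expr1.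
rewrite (_ : (fun y => _) = fun y => rho y * rho y ^+ k.+1); last first.
  by apply/funext => y'; rewrite exprS.
have := is_pdM (is_pd_rho (a := a) y) IH.
suff -> : (a == ord_max)%:R * rho y ^+ k.+1 +
    rho y * ((a == ord_max)%:R * (k.+1%:R * rho y ^+ k)) =
    (a == ord_max)%:R * (k.+2%:R * rho y ^+ k.+1) :> R by [].
by rewrite exprS -natr1; ring.
Qed.

Section RelopenJets.
Variables (V : set pt3) (y : pt3).
Hypothesis oV : relopen V.
Hypothesis Vy : \forall t \near (0 : R)^'+, V (vertical y t).
Hypothesis y0 : rho y = 0.

(** One power of [rho] absorbs the logarithm, and derivatives in [rho] reproduce
terms of the same shape with a smaller exponent.  The bound [n <= k] keeps a
power of [rho] in front of the logarithm in all derivatives considered. *)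
Lemma jet_rhoX_ln n k : (forall y', V y' -> 0 < rho y') -> (n <= k)%N ->
  jet V y n k (fun y => rho y ^+ k.+1 * ln (rho y)).
Proof.
move=> Vpos; elim: n k => [|n IH] k nk.
  by split=> //; exact: vanish_rhoX_ln.
case: k nk => // k nk.
apply: (jet_is_pd oV Vy (df := fun a y => (a == ord_max)%:R *
    (k.+2%:R * (rho y ^+ k.+1 * ln (rho y)) + rho y ^+ k.+1))).
- exact: vanish_rhoX_ln.
- move=> a y' /Vpos y'0.
  have := is_pdM (@is_pd_rhoX a y' k.+1)
     (is_pd_comp_rho (dphi := GRing.inv) (a := a) (is_derive1_ln y'0)).
  suff -> : (a == ord_max)%:R * (k.+2%:R * rho y' ^+ k.+1) * ln (rho y') +
      rho y' ^+ k.+2 * ((a == ord_max)%:R / rho y') = (a == ord_max)%:R *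
    (k.+2%:R * (rho y' ^+ k.+1 * ln (rho y')) + rho y' ^+ k.+1) :> R by [].
  by rewrite [in rho y' ^+ k.+2 * _]exprS; field; rewrite gt_eqF.
- move=> a; case: (a == _); last first.
    by apply: (jet_ext oV Vy) (jet0 oV Vy _ _) => y' _; rewrite mul0r.
  apply: (jet_ext oV Vy
    (f := fun y => k.+2%:R * (rho y ^+ k.+1 * ln (rho y)) + rho y ^+ k.+1)).
    by move=> y' _; rewrite mul1r.
  apply: jetD => //.
    by rewrite subn1; apply: jetZ => //; exact: IH.
  by apply: (jet_le (k := k.+1)); [lia | exact: jet_rhoX].
Qed.

(** Such an [f] has tangential derivatives that are zero at the boundary point
[y], so [f] and these derivatives are O(t) by derivability in [rho]. *)
Lemma jet_boundary f : V y -> jet V y 2 0 f ->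
  (forall y', V y' -> rho y' = 0 -> f y' = 0) -> jet V y 1 1 f.
Proof.
move=> Vyy jf fb.
have hy := relopen_half oV Vyy.
have vf g : pderivable ord_max g y -> g y = 0 -> vanish y 1 g.
  move=> gd g0; have := vanish_pderivable hy gd.
  by apply: vanish_near; apply: nearW => t; rewrite g0 subr0.
have [_ H] := jf.
split; first by apply: vf; [exact: (H ord_max).1 | exact: fb].
move=> a; have [fa ja] := H a; split=> //.
split=> //; case: eqP => [->|/eqP am].
  by have := (H ord_max).2.1; rewrite sub0n subnn.
apply: vf; first exact: (ja.2 ord_max).1.
apply: (is_pd_pd hy _).2; apply: is_pd_near (is_pd_cst a 0 y).
  by rewrite fb.
apply: filterS (relopen_approach a oV Vyy) => h Vh.
by rewrite fb// rho_shift y0 (negbTE am) mulr0 addr0.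
Qed.

(** A linear function of [t] that is O(t^2) is zero: this reads off the
coefficient of [rho]. *)
Lemma vanish_eq0 (r : R) : vanish y 2 (fun y => rho y * r) -> r = 0.
Proof.
move=> [C H]; apply/eqP; rewrite -normr_le0; apply/ler_addgt0Pl => e e0.
rewrite addr0.
near (0 : R)^'+ => t.
have t0 : 0 < t by near: t; exact: nbhs_right_gt.
have : `|rho (vertical y t) * r| <= C * t ^+ 2 by near: t.
rewrite /vertical rho_shift y0 eqxx add0r mulr1 normrM (gtr0_norm t0).
rewrite expr2 mulrCA ler_pM2l// => /le_trans; apply.
apply: (@le_trans _ _ (t * (`|C| + 1))).
  by rewrite mulrC ler_pM2l// (le_trans (ler_norm C))// lerDl.
rewrite -ler_pdivlMr ?ltr_wpDl//; near: t; apply: nbhs_right_le.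
by rewrite divr_gt0// ltr_wpDl.
Unshelve. all: by end_near. Qed.

End RelopenJets.

(** * Tensor fields built from smooth ones *)

Section Tame.
Variables (V : set pt3) (y : pt3).
Hypothesis oV : relopen V.
Hypothesis Vy : V y.

Lemma relopen_vertical : \forall t \near (0 : R)^'+, V (vertical y t).
Proof.
exact: (at_right_approach (oV Vy).1 (relopen_approach ord_max oV Vy)).
Qed.
Let Vl := relopen_vertical.

(** The part of smoothness that the estimates use, stable under all operations
by which the connection form and the curvature are built from the structure. *)
Definition tame f := forall n, jet V y n 0 f.

Lemma tame_smooth f : smooth_on V f -> tame f.
Proof. by move=> fs n; exact: jet_smooth. Qed.

Lemma tame_cst (r : R) : tame (fun=> r).
Proof. by move=> n; exact: jet_cst. Qed.

Lemma tame_add f g : tame f -> tame g -> tame (fun y => f y + g y).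
Proof. by move=> tf tg n; exact: jetD. Qed.

Lemma tame_sub f g : tame f -> tame g -> tame (fun y => f y - g y).
Proof. by move=> tf tg n; exact: jetB. Qed.

Lemma tame_opp f : tame f -> tame (fun y => - f y).
Proof. by move=> tf n; exact: jetN. Qed.

Lemma tame_mul f g : tame f -> tame g -> tame (fun y => f y * g y).
Proof. by move=> tf tg n; exact: (@jetM _ V y oV Vl n 0 0). Qed.

Lemma tame_sum (I : Type) (r : seq I) (F : I -> pt3 -> R) :
  (forall i, tame (F i)) -> tame (fun y => \sum_(i <- r) F i y).
Proof. by move=> tF n; apply: jet_sum => // i _; exact: tF. Qed.

Lemma tame_pd a f : tame f -> tame (pd a f).
Proof. by move=> tf n; have := pd_jet a (tf n.+1); rewrite sub0n. Qed.

Definition mx_tame m n (A : pt3 -> 'M[R]_(m, n)) :=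
  forall i j, tame (fun y => A y i j).

Lemma mx_tame_cst m n (A : 'M[R]_(m, n)) : mx_tame (fun=> A).
Proof. by move=> i j; exact: tame_cst. Qed.

Lemma mx_tame_mul m n p (A : pt3 -> 'M[R]_(m, n)) (B : pt3 -> 'M[R]_(n, p)) :
  mx_tame A -> mx_tame B -> mx_tame (fun y => A y *m B y).
Proof.
move=> tA tB i j; under eq_fun do rewrite mxE.
by apply: tame_sum => k; exact: tame_mul.
Qed.

Lemma tame_ev (alpha : pt3 -> 'cV[R]_3) (X : pt3 -> pt3) :
  mx_tame alpha -> mx_tame X -> tame (fun y => ev (alpha y) (X y)).
Proof. by move=> talpha tX; exact: mx_tame_mul. Qed.

Lemma tame_dform (alpha : pt3 -> 'cV[R]_3) (X Y : pt3 -> pt3) :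
  mx_tame alpha -> mx_tame X -> mx_tame Y ->
  tame (fun y => dform alpha y (X y) (Y y)).
Proof.
move=> talpha tX tY; rewrite /dform; apply: tame_sum => a; apply: tame_sum => b.
apply: tame_mul => //; apply: tame_mul => //.
by apply: tame_sub; exact: tame_pd.
Qed.

Lemma mx_tame_nabla (G : christoffel R) (X Y : pt3 -> pt3) :
  (forall a b, mx_tame (fun y => G y a b)) -> mx_tame X -> mx_tame Y ->
  mx_tame (fun y => nabla G y (X y) Y).
Proof.
move=> tG tX tY i k; under eq_fun do rewrite mxE.
apply: tame_sum => a; apply: tame_mul => //; apply: tame_add.
  exact: tame_pd.
by apply: tame_sum => b; apply: tame_mul => //; exact: tG.
Qed.

End Tame.
End MoreJets.

(** * The frame, the connection form and the curvature in a normal chart *)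

Section Geometry.
Context {R : realType} {M : bmanifold R} (P : pseudohermitian M).
Variables (c : chart R M) (G : christoffel R).
Local Notation pt3 := 'rV[R]_3.
Hypothesis hc : normal_chart P c G.

Lemma atlas_chart : is_chart c.
Proof. by have [+ _ _ _] := hc; case: M P c => ? ? ? ? H ? ? ? ? ?; exact: H. Qed.

Lemma cod_relopen : relopen (cod c).
Proof.
have [_ [W oW cW] _ _ _] := atlas_chart.
move=> y; rewrite cW => -[Wy hy]; split=> //.
have : \forall y' \near y, W y' by exact: open_nbhs_nbhs.
by apply: filterS => y' Wy' hy'.
Qed.

Lemma inside_relopen : relopen (inside c).
Proof.
move=> y [cy ry]; have [hy Vy] := cod_relopen cy; split=> //.
have rn : \forall y' \near y, 0 < rho y'.
  have := @coord_continuous R 1 3 ord0 ord_max y.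
  by move/(cvgr_gt (rho y)); apply.
by apply: filterS2 Vy rn => y' Vy' ry' hy'; split; [exact: Vy' | exact: ry'].
Qed.

Lemma inside_sub : inside c `<=` cod c.
Proof. by move=> y []. Qed.

Lemma structure_smooth :
  mx_smooth_on (cod c) (theta P c) /\ mx_smooth_on (cod c) (J P c).
Proof.
have [+ _ _ _] := hc; case: P => th JJ re H1 H2 H3 H4 H5 H6 ac.
by have [] := H1 _ ac.
Qed.

Lemma J_squared y X : cod c y -> xi P c y X -> X *m J P c y *m J P c y = - X.
Proof.
have [+ _ _ _] := hc; case: P => th JJ re H1 H2 H3 H4 H5 H6 ac cy.
by have [_ _] := H5 _ ac _ cy; exact.
Qed.

(** The [rho]-line is the geodesic with initial velocity [J X], where [X] is
tangent to the boundary and to [xi]; hence [e_1 = - J J X = X] on the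
boundary. *)
Lemma rho_coordinate_e1 y : cod c y -> rho y = 0 -> e1 P c y ord0 ord_max = 0.
Proof.
move=> cy y0; have [_ _ _ /(_ y cy y0)] := hc.
move=> [_ [X]] [tX xX _ _ [_ XJ]].
have E : X *m J P c y = basis_vec ord_max.
  apply/rowP => k; rewrite -XJ.
  have near_cod : \forall t \near (0 : R)^'+, cod c (vertical y t).
    exact: relopen_vertical cod_relopen cy.
  rewrite /derive_in; set D := [set t | _ /\ _].
  have FP : ProperFilter (within [set h | D (0 + h)] (0 : R)^').
    apply: within_dnbhs_proper; apply: filterS2 near_cod (nbhs_right_gt 0).
    by move=> t ct t0; rewrite /= add0r; split=> //; exact: ltW.
  apply: cvg_lim => //; apply: cvg_near_cst.
  rewrite near_withinE; apply: filterS (nbhs_dnbhs_neq (0 : R)) => t t0 _.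
  rewrite /diff_quotient add0r scale0r addr0 [X in X - _]mxE addrAC subrr add0r.
  by rewrite mxE mulKf.
rewrite /e1 /e2 -E J_squared// opprK; exact: tX.
Qed.

Section AtBoundary.
Variable y : pt3.
Hypothesis cy : cod c y.
Hypothesis y0 : rho y = 0.
Local Notation tame := (tame (cod c) y).
Local Notation mx_tame := (mx_tame (cod c) y).
Let oV := cod_relopen.

Lemma tame_theta : mx_tame (theta P c).
Proof. by move=> i j; apply: tame_smooth => //; exact: structure_smooth.1. Qed.

Lemma tame_J : mx_tame (J P c).
Proof. by move=> i j; apply: tame_smooth => //; exact: structure_smooth.2. Qed.

Lemma tame_christoffel a b : mx_tame (fun y => G y a b).
Proof.
by move=> i j; apply: tame_smooth => //; have [_ [/(_ a b)]] := hc.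
Qed.

Lemma tame_e2 : mx_tame (@e2 R).
Proof. exact: mx_tame_cst. Qed.

Lemma tame_e1 : mx_tame (e1 P c).
Proof.
move=> i j; under eq_fun do rewrite mxE.
by apply: tame_opp => //; apply: mx_tame_mul => //; [exact: tame_e2|exact: tame_J].
Qed.

Lemma tame_g (X Y : pt3 -> pt3) : mx_tame X -> mx_tame Y ->
  tame (fun y => g P c y (X y) (Y y)).
Proof.
move=> tX tY; have tt := tame_theta.
apply: tame_add => //; apply: tame_mul => //.
- exact: tame_ev.
- exact: tame_ev.
- exact: tame_cst.
- by apply: tame_dform => //; apply: mx_tame_mul => //; exact: tame_J.
Qed.

Lemma tame_omega : mx_tame (omega P c G).
Proof.
move=> i j; under eq_fun do rewrite mxE.
apply: tame_g; last exact: tame_e2.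
apply: mx_tame_nabla => //; [exact: tame_christoffel|exact: mx_tame_cst|].
exact: tame_e1.
Qed.

Lemma tame_webster : tame (webster_curvature P c G).
Proof.
apply: tame_opp => //; apply: tame_mul => //; first exact: tame_cst.
by apply: tame_dform => //; [exact: tame_omega|exact: tame_e1|exact: tame_e2].
Qed.

Local Notation I := (inside c).
Let oI := inside_relopen.

Lemma inside_vertical : \forall t \near (0 : R)^'+, I (vertical y t).
Proof.
have cv := relopen_vertical oV cy.
apply: filterS2 cv (nbhs_right_gt 0) => t ct t0; split=> //.
by rewrite /vertical rho_shift y0 eqxx add0r mulr1.
Qed.
Let Iy := inside_vertical.

Lemma tame_jet n f : tame f -> jet I y n 0 f.
Proof. by move=> /(_ n); apply: jet_sub; exact: inside_sub. Qed.

Lemma jet_rho_e1 : jet I y 1 1 (fun y => e1 P c y ord0 ord_max).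
Proof.
apply: (jet_sub inside_sub); apply: jet_boundary => //.
  exact: tame_e1.
by move=> y' cy' y'0; exact: rho_coordinate_e1.
Qed.

Lemma act_e2 f : act (@e2 R) f = pd ord_max f.
Proof.
apply/funext => y'; rewrite /act (bigD1 ord_max)//= big1 ?addr0.
  by rewrite /e2 /basis_vec mxE !eqxx mul1r.
by move=> a am; rewrite /e2 /basis_vec mxE (negbTE am) mul0r.
Qed.

(** The term of [e_1 f] that differentiates in [rho], and so loses one order,
has a coefficient of weight 1 which makes up for the loss. *)
Lemma jet_act_e1 n f : (n <= 1)%N -> jet I y n.+1 1 f -> jet I y n 1 (act (e1 P c) f).
Proof.
move=> n1 jf; apply: jet_sum => // a _.
have := pd_jet a jf; have [->|am] /= := eqVneq a ord_max.
  rewrite subnn => jaf; have je : jet I y n 1 (fun y => e1 P c y ord0 ord_max).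
    by case: n n1 {jf jaf} => [_|[_|//]]; [apply: jetS|]; exact: jet_rho_e1.
  exact: (jetM oI Iy je jaf).
rewrite subn0 => jaf.
exact: (jetM oI Iy (tame_jet n (tame_e1 ord0 a)) jaf).
Qed.

(** * The Yamabe operator on rho + V rho^2 + O(rho^3) *)

Variables (U V : pt3 -> R).
Hypothesis tV : tame V.
Hypothesis UV : jet I y 2 3 (fun y => U y - (rho y + V y * rho y ^+ 2)).
Let E y' := U y' - (rho y' + V y' * rho y' ^+ 2).

Let UE y' : U y' = rho y' + V y' * rho y' ^+ 2 + E y'.
Proof. by rewrite /E addrC subrK. Qed.

Let JV n := tame_jet n tV.
Let Jrho n : jet I y n 1 (@rho R).
Proof. exact: jet_rho. Qed.
Let Jrho2 n : jet I y n 2 (fun y => rho y ^+ 2).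
Proof. exact: jet_rhoX. Qed.

Lemma jet_U_rho : jet I y 2 2 (fun y => U y - rho y).
Proof.
have J2 := jet_le (ltnW (ltnSn 2)) UV.
apply: (jet_ext oI Iy _ (jetD oI Iy (jetM oI Iy (JV 2) (Jrho2 2)) J2)) => y' _.
by ring.
Qed.

Lemma jet_U : jet I y 2 1 U.
Proof.
have J1 := jet_le (leqnSn 1) jet_U_rho.
by apply: (jet_ext oI Iy _ (jetD oI Iy (Jrho 2) J1)) => y' _; ring.
Qed.

Lemma jet_dU : jet I y 1 2 (fun y => pd ord_max U y - (1 + 2 * (V y * rho y))).
Proof.
apply: (jet_ext oI Iy (f := fun y => pd ord_max V y * rho y ^+ 2 + pd ord_max E y)).
  move=> y' Iy'; apply/esym/eqP; rewrite subr_eq; apply/eqP.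
  apply: (is_pd_pd (relopen_half oI Iy') _).2.
  have H := is_pdD
    (is_pdD (is_pd_rho (a := ord_max) y')
       (is_pdM (jet_pd (a := ord_max) (JV 2) Iy') (@is_pd_rhoX R ord_max y' 1)))
    (jet_pd (a := ord_max) UV Iy').
  apply: (is_pd_ext oI Iy' (f := fun y => rho y + V y * rho y ^+ 2 + E y)).
    by move=> y'' _; rewrite UE.
  move: H; rewrite eqxx -/E; set l := (X in is_pd _ _ _ X).
  set l' := (X in _ -> is_pd _ _ _ X).
  suff -> : l = l' by [].
  by rewrite /l /l' expr1 /=; ring.
apply: (jetD oI Iy); last by have := pd_jet ord_max UV; rewrite eqxx.
exact: (jetM oI Iy (tame_jet 1 (tame_pd ord_max tV)) (Jrho2 1)).
Qed.

Lemma vanish_ddU : vanish y 1 (fun y => pd ord_max (pd ord_max U) y - 2 * V y).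
Proof.
pose D y := pd ord_max U y - (1 + 2 * (V y * rho y)).
apply: (vanish_ext Iy (f := fun y => 2 * (pd ord_max V y * rho y) + pd ord_max D y)).
  move=> y' Iy'; apply/esym/eqP; rewrite subr_eq; apply/eqP.
  apply: (is_pd_pd (relopen_half oI Iy') _).2.
  have H := is_pdD
    (is_pdD (is_pd_cst ord_max 1 y')
       (is_pdM (is_pd_cst ord_max 2 y')
          (is_pdM (jet_pd (a := ord_max) (JV 2) Iy') (is_pd_rho (a := ord_max) y'))))
    (jet_pd (a := ord_max) jet_dU Iy').
  apply: (is_pd_ext oI Iy' (f := fun y => 1 + 2 * (V y * rho y) + D y)).
    by move=> y'' _; rewrite /D; ring.
  move: H; rewrite eqxx -/D; set l := (X in is_pd _ _ _ X).
  set l' := (X in _ -> is_pd _ _ _ X).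
  suff -> : l = l' by [].
  by rewrite /l /l' /=; ring.
apply: jet_vanish; apply: (jetD oI Iy); last exact: (pd_jet ord_max jet_dU).
apply: jetZ => //.
exact: (jetM oI Iy (tame_jet 0 (tame_pd ord_max tV)) (Jrho 0)).
Qed.

Let Omega y' := ev (omega P c G y') (e1 P c y').

(** Of the four terms of the sublaplacian, the second tends to [2 V], the third
to [- Omega] and the two that contain [e_1 U] to 0. *)
Lemma vanish_sublaplacian :
  vanish y 1 (fun y => sublaplacian P c G U y - (2 * V y - Omega y)).
Proof.
have tO : tame Omega by apply: tame_ev => //; [exact: tame_omega|exact: tame_e1].
have tO2 : tame (fun y => ev (omega P c G y) (e2 y)).
  by apply: tame_ev => //; [exact: tame_omega|exact: tame_e2].
have e1U := jet_act_e1 (leqnn 1) jet_U.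
have e1e1U := jet_vanish (jet_act_e1 (leq0n 1) e1U).
have dU1 : jet I y 0 1 (fun y => pd ord_max U y - 1).
  have dU := jet_le (leqnSn 1) (jetS jet_dU).
  have VR := jetZ oI Iy 2 (jetM oI Iy (JV 0) (Jrho 0)).
  by apply: (jet_ext oI Iy _ (jetD oI Iy dU VR)) => y' _; ring.
have T3 := jet_vanish (jetN oI Iy (jetM oI Iy (tame_jet 0 tO) dU1)).
have T4 := jet_vanish (jetM oI Iy (tame_jet 0 tO2) (jetS e1U)).
apply: (vanish_ext Iy _ (vanishD (vanishD e1e1U vanish_ddU) (vanishD T3 T4))) => y' _.
by rewrite /sublaplacian !act_e2 /Omega; ring.
Qed.

(** The contributions to the coefficient of [rho] are [4 V] from the gradient
and [- (2 V - Omega) / 2] from [- u triangle_P u / 2]. *)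
Lemma yamabe_first_order :
  vanish y 2 (fun y => yamabe_lhs P c G U y - 1 - rho y * (3 * V y + 2^-1 * Omega y)).
Proof.
have e1U := jet_vanish (jet_act_e1 (leqnn 1) jet_U).
have VU := jet_vanish jet_U.
have tO : tame Omega by apply: tame_ev => //; [exact: tame_omega|exact: tame_e1].
pose D y := pd ord_max U y - (1 + 2 * (V y * rho y)).
have vD : vanish y 2 D := jet_vanish jet_dU.
have cst0 k := vanish_cst y k.
have vr := vanish_rho y0.
have V0 := jet_vanish (JV 0).
have VR : vanish y 1 (fun y => V y * rho y) := vanishM V0 vr.
(* With [D] the error in [d U / d rho], [S] the sublaplacian and [W] the Webster
   curvature, the difference is the sum of [(e_1 U)^2], [4 (V rho)^2], [D^2],
   [2 D (1 + 2 V rho)], [- U (S - (2 V - Omega)) / 2],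
   [- (U - rho) (2 V - Omega) / 2] and [- W U^2 / 4]. *)
have T1 : vanish y 2 _ := vanishM e1U e1U.
have T2 : vanish y 2 _ := vanishM (cst0 4) (vanishM VR VR).
have T3 : vanish y 2 _ := vanish_le (leq_addl 2 2) (vanishM vD vD).
have dU0 : vanish y 0 (fun y => 1 + 2 * (V y * rho y)).
  apply: vanishD; first exact: cst0.
  by apply: (vanish_le (leq0n 1)); exact: (vanishM (cst0 2) VR).
have T4 : vanish y 2 _ := vanishM (vanishM (cst0 2) vD) dU0.
have T5 : vanish y 2 _ := vanishM (vanishM (cst0 (- 2^-1)) VU) vanish_sublaplacian.
have T6 : vanish y 2 _ := vanishM (vanishM (cst0 (- 2^-1)) (jet_vanish jet_U_rho))
  (jet_vanish
     (tame_jet 0 (tame_sub oV cy (tame_mul oV cy (tame_cst oV cy 2) tV) tO))).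
have T7 : vanish y 2 _ := vanishM
  (vanishM (cst0 (- (8^-1 * 2))) (jet_vanish (tame_jet 0 tame_webster)))
  (vanishM VU VU).
apply: (vanish_ext Iy _ (vanishD T1 (vanishD T2 (vanishD T3
  (vanishD T4 (vanishD T5 (vanishD T6 T7))))))) => y' _.
rewrite /yamabe_lhs /sqnorm_dP act_e2 /D; set S := sublaplacian _ _ _ _ _.
by field.
Qed.

Lemma second_coefficient :
  vanish y 2 (fun y => yamabe_lhs P c G U y - 1) -> V y = - (6^-1 * Omega y).
Proof.
move=> HY.
have tO : tame Omega by apply: tame_ev => //; [exact: tame_omega|exact: tame_e1].
(* [Q] may be replaced by its value at [y], which turns [rho Q] into a linear
   function on the segment. *)
pose Q y := 3 * V y + 2^-1 * Omega y.
have tQ : tame Q.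
  by apply: tame_add => //; apply: tame_mul => //; exact: tame_cst.
have [_ /(_ ord_max)[/(_ y cy) Qd _]] := tQ 1%N.
have Q1 : vanish y 2 _ :=
  vanishM (vanish_rho y0) (vanish_pderivable (cod_relopen cy).1 Qd).
have : Q y = 0.
  apply: (vanish_eq0 y0).
  have N1 := vanish_cst y (-1 : R).
  apply: (vanish_ext Iy _ (vanishD (vanishD HY (vanishM N1 yamabe_first_order))
    (vanishM N1 Q1))) => y' _; rewrite /Q; ring.
rewrite /Q; lra.
Qed.

End AtBoundary.
End Geometry.

(** * Formal solutions *)

Section FormalSolution.
Context {R : realType} {M : bmanifold R} (P : pseudohermitian M).
Variables (c : chart R M) (G : christoffel R) (u v w z l h : M -> R).
Hypothesis hc : normal_chart P c G.
Hypothesis hu : formal_solution P c G u v w z l h.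
Variable y : 'rV[R]_3.
Hypothesis cy : cod c y.
Hypothesis y0 : rho y = 0.
Local Notation I := (inside c).
Local Notation at_foot f := (fun y => f (pnt c (foot y))).
Let oI := inside_relopen hc.
Let Iy := inside_vertical hc cy y0.

Lemma smooth_term (f phi : 'rV[R]_3 -> R) j k : smooth_on (cod c) f -> (j <= k)%N ->
  jet I y 2 k phi -> jet I y 2 j (fun y => f y * phi y).
Proof.
move=> fs jk jp; apply: (jet_le jk).
exact: (jetM oI Iy (tame_jet 2 (tame_smooth (cod_relopen hc) cy fs)) jp).
Qed.

(** Terms of order 3 and higher of the expansion have explicit jets; the
remainder inherits its derivability from [u] and the expansion, and its bounds
are part of the hypothesis. *)
Lemma formal_solution_jet :
  jet I y 2 3 (fun y => u (pnt c y) - (rho y + v (pnt c (foot y)) * rho y ^+ 2)).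
Proof.
have [[sv sw sz sl sh] CU _ /(_ y cy y0) rem _] := hu.
have Jr k : jet I y 2 k (fun y => rho y ^+ k) by exact: jet_rhoX.
have Jl : jet I y 2 4 (fun y => rho y ^+ 5 * ln (rho y)).
  by apply: jet_rhoX_ln => // y' [].
pose tail y := at_foot w y * rho y ^+ 3 + at_foot z y * rho y ^+ 4
  + at_foot l y * (rho y ^+ 5 * ln (rho y)) + at_foot h y * rho y ^+ 5.
have Jtail : jet I y 2 3 tail.
  apply: jetD => //; last exact: smooth_term (Jr 5).
  apply: jetD => //; last exact: smooth_term Jl.
  by apply: jetD => //; [exact: smooth_term (Jr 3)|exact: smooth_term (Jr 4)].
pose expansion y := rho y + at_foot v y * rho y ^+ 2 + at_foot w y * rho y ^+ 3
    + at_foot z y * rho y ^+ 4 + at_foot l y * (rho y ^+ 5 * ln (rho y))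
    + at_foot h y * rho y ^+ 5.
have Jexp : jet I y 2 1 expansion.
  have J3 := jet_le (leq0n 2 : (1 <= 3)%N) Jtail.
  have J2 : jet I y 2 1 (fun y => at_foot v y * rho y ^+ 2).
    exact: smooth_term (Jr 2).
  have J1 : jet I y 2 1 rho by exact: jet_rho.
  apply: (jet_ext oI Iy _ (jetD oI Iy (jetD oI Iy J1 J2) J3)) => y' _.
  by rewrite /expansion /tail; ring.
have Jrem : jet I y 2 6 (fun y => u (pnt c y) - expansion y).
  apply: jet_bounds.
    apply: (derivable_uptoB oI); last exact: jet_derivable_upto Jexp.
    move=> s a s2 y' Iy'; have [_] := CU s (ltnW s2).
    by move=> /(_ s2 a y' Iy').
  move=> s s2; apply: vanish_bigO Iy (rem s s2) _.
  exact: jet_vanish (jet_rhoX oI Iy y0 0 _).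
have Jrem3 := jet_le (leq0n 3 : (3 <= 6)%N) Jrem.
apply: (jet_ext oI Iy _ (jetD oI Iy Jrem3 Jtail)) => y' _.
by rewrite /expansion /tail; ring.
Qed.

Lemma formal_solution_equation :
  vanish y 2 (fun y => yamabe_lhs P c G (fun y => u (pnt c y)) y - 1).
Proof.
have [_ _ _ _ /(_ y cy y0) Y] := hu.
apply: vanish_bigO Iy Y _.
exact: vanish_le (vanish_rhoX_ln 4 y0).
Qed.

End FormalSolution.

Theorem proposition12 (R : realType) (M : bmanifold R) (P : pseudohermitian M)
    (c : chart R M) (G : christoffel R) (hc : normal_chart P c G)
    (u v w z l h : M -> R) (hu : formal_solution P c G u v w z l h)
    (x : M) (hx : @boundary R M x) (hxc : dom c x) :
  v x = - (6^-1 * p_mean_curvature P c G x).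
Proof.
have [ac _ _ _] := hc.
have y0 : rho (crd c x) = 0 by exact: hx.
have cy : cod c (crd c x) by exists x.
have [[sv _ _ _ _] _ _ _ _] := hu.
have vx : v x = v (pnt c (foot (crd c x))).
  have [_ _ crdK _ _] := atlas_chart hc.
  by rewrite /foot y0 scale0r subr0 crdK// inE.
rewrite vx; apply: (second_coefficient hc cy y0 (V := fun y => v (pnt c (foot y)))
  (U := fun y => u (pnt c y))).
- exact: (tame_smooth (cod_relopen hc) cy sv).
- exact: (formal_solution_jet hc hu cy y0).
- exact: (formal_solution_equation hc hu cy y0).
Qed.
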